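(* Let $n=2^k+r$ with integers $k\ge 0$ and $0<r<2^k$, and let $\rho_1$ be the position of the smallest nonzero bit in the binary expansion of $r$ (positions numbered from $0$ at the least significant bit). The number $\delta(n)$ of $D$-nodes in a divide-and-conquer tree with $n$ leaf nodes satisfies $$\delta(n)=\frac12\left(\delta(n-1)+\delta(n+1)\right)+1-\rho_1.$$
   Context: A full binary tree is a rooted binary tree in which every interior node has exactly two children. An interior node of a full binary tree is an $S$-node if its two subtrees have the same number of leaves, and a $D$-node if its two subtrees have different numbers of leaves. A divide-and-conquer tree is a full binary tree in which the numbers of leaf descendants of the left and right children of any interior node differ by at most $1$ (a child that is a leaf counts as having one leaf). For each $m\ge 1$ there is exactly one such tree with $m$ leaves up to tree isomorphism; $\delta(m)$ denotes its number of $D$-nodes. *)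

(* Defs.v *)
From mathcomp Require Import all_boot all_order all_algebra.
From mathcomp Require Import zify.

Set Implicit Arguments.
Unset Strict Implicit.
Unset Printing Implicit Defensive.

Inductive fbtree : Type :=
| Leaf
| Node of fbtree & fbtree.

Fixpoint leaves (t : fbtree) : nat :=
  if t is Node l r then leaves l + leaves r else 1.

Fixpoint dnodes (t : fbtree) : nat :=
  if t is Node l r then (leaves l != leaves r) + (dnodes l + dnodes r) else 0.

Fixpoint is_dctree (t : fbtree) : bool :=
  if t is Node l r then
    [&& leaves l <= (leaves r).+1, leaves r <= (leaves l).+1,
        is_dctree l & is_dctree r]
  else true.

(* Isomorphism of rooted trees: the children of a node are unordered. *)
Fixpoint fbtree_iso (t u : fbtree) : bool :=
  match t, u with
  | Leaf, Leaf => true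
  | Node l r, Node l' r' =>
      (fbtree_iso l l' && fbtree_iso r r') ||
      (fbtree_iso l r' && fbtree_iso r l')
  | _, _ => false
  end.

(* The new leaf goes to the right child, and the children are swapped. Starting
   from a leaf, this keeps the left child equal to the right one in number of
   leaves, or larger by exactly one. *)
Fixpoint add_leaf (t : fbtree) : fbtree :=
  if t is Node l r then Node (add_leaf r) l else Node Leaf Leaf.

(* A representative of the divide-and-conquer trees with m leaves, for m >= 1;
   dctree 0 is the junk value Leaf. *)
Definition dctree (m : nat) : fbtree := iter m.-1 add_leaf Leaf.

Definition delta (m : nat) : nat := dnodes (dctree m).

Definition bit (m i : nat) : bool := odd (m %/ 2 ^ i).

Lemma leaves_gt0 t : 0 < leaves t.
Proof. by elim: t => //= l IHl r IHr; rewrite addn_gt0 IHl. Qed.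

Lemma leaves_add_leaf t : leaves (add_leaf t) = (leaves t).+1.
Proof. by elim: t => //= l IHl r IHr; rewrite IHr addSn addnC. Qed.

Lemma leaves_dctree m : 0 < m -> leaves (dctree m) = m.
Proof.
case: m => // m _; rewrite /dctree /=.
by elim: m => //= m IHm; rewrite leaves_add_leaf IHm.
Qed.

Fixpoint left_heavy (t : fbtree) : bool :=
  if t is Node l r then
    [&& leaves r <= leaves l <= (leaves r).+1, left_heavy l & left_heavy r]
  else true.

Lemma left_heavy_add_leaf t : left_heavy t -> left_heavy (add_leaf t).
Proof.
elim: t => //= l IHl r IHr /and3P[/andP[h1 h2] hl hr].
by rewrite leaves_add_leaf hl IHr // h2 ltnS h1.
Qed.

Lemma left_heavy_is_dctree t : left_heavy t -> is_dctree t.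
Proof.
elim: t => //= l IHl r IHr /and3P[/andP[h1 h2] /IHl-> /IHr->].
by rewrite h2 (leq_trans h1).
Qed.

Lemma dctreeP m : is_dctree (dctree m).
Proof.
apply: left_heavy_is_dctree; rewrite /dctree.
by elim: m.-1 => //= n IHn; apply: left_heavy_add_leaf.
Qed.

Lemma dctree_uniq t u :
  is_dctree t -> is_dctree u -> leaves t = leaves u -> fbtree_iso t u.
Proof.
elim: t u => [|l IHl r IHr] [|l' r'] //=.
- by move=> _ _; have := leaves_gt0 l'; have := leaves_gt0 r'; lia.
- by move=> _ _; have := leaves_gt0 l; have := leaves_gt0 r; lia.
move=> /and4P[h1 h2 hl hr] /and4P[h1' h2' hl' hr'] e.
have [el|nl] := eqVneq (leaves l) (leaves l').
  by rewrite IHl // IHr //; lia.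
by rewrite (IHl r') ?(IHr l') ?orbT //; lia.
Qed.

Lemma fbtree_iso_leaves t u : fbtree_iso t u -> leaves t = leaves u.
Proof.
elim: t u => [|l IHl r IHr] [|l' r'] //=.
by case/orP=> /andP[/IHl-> /IHr->] //; rewrite addnC.
Qed.

Lemma fbtree_iso_dnodes t u : fbtree_iso t u -> dnodes t = dnodes u.
Proof.
elim: t u => [|l IHl r IHr] [|l' r'] //=.
case/orP=> /andP[hl hr].
  by rewrite (IHl _ hl) (IHr _ hr) (fbtree_iso_leaves hl) (fbtree_iso_leaves hr).
rewrite (IHl _ hl) (IHr _ hr) (fbtree_iso_leaves hl) (fbtree_iso_leaves hr).
by rewrite eq_sym (addnC (dnodes r')).
Qed.

(* delta m does not depend on the representative chosen in dctree. *)
Lemma delta_dnodes t : is_dctree t -> delta (leaves t) = dnodes t.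
Proof.
move=> ht; apply/fbtree_iso_dnodes/dctree_uniq => //; first exact: dctreeP.
by rewrite leaves_dctree ?leaves_gt0.
Qed.

(* Main.v *)
Require Import Defs.
From mathcomp Require Import all_boot all_order all_algebra.
From mathcomp Require Import zify lra.

Set Implicit Arguments.
Unset Strict Implicit.
Unset Printing Implicit Defensive.

(** The root of a divide-and-conquer tree splits the leaves as evenly as
possible, so [delta] obeys, for [m > 0], the recurrences
[delta (2m) = 2 delta m] (the root is an S-node) and
[delta (2m+1) = delta m + delta (m+1) + 1] (the root is a D-node).

Multiplying the identity to be proved by two turns it into one about the second
difference of [delta]:
[delta (n-1) + delta (n+1) + 2 = 2 delta n + 2 rho1].
Here [rho1], the lowest bit of [r], is also the exponent [a] of two in
[n = 2^a (2q+1)], because [2^a <= r < 2^k]; for the same reason the odd part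
[2q+1] is larger than one. The second difference is then computed by induction
on [a] ([delta_second_difference]). If [n] is odd, both neighbours are even and
the [+1] of the D-root of [n] is the whole discrepancy. If [n = 2m], both
neighbours are odd, and unfolding them produces the second difference at [m]
plus the two D-roots of the neighbours, which is the increase by two that
matches the increase of [a] by one. The condition [q > 0] is what fails for
powers of two, where the halving would end at [n = 1], whose left neighbour
has no tree. *)

(** Every divide-and-conquer tree with the right number of leaves computes
[delta] ([delta_dnodes]), so both recurrences are read off a tree built by
joining two smaller representatives at a new root. *)
Lemma delta_double m : 0 < m -> delta m.*2 = (delta m).*2.
Proof.
move=> m_gt0; rewrite -{1}addnn -{1 2}(leaves_dctree m_gt0).
rewrite -/(leaves (Node (dctree m) (dctree m))) delta_dnodes /=.
  by rewrite eqxx addnn.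
by rewrite leqnSn dctreeP.
Qed.

Lemma delta_doubleS m :
  0 < m -> delta m.*2.+1 = (delta m + delta m.+1).+1.
Proof.
move=> m_gt0.
have -> : m.*2.+1 = leaves (Node (dctree m) (dctree m.+1)).
  by rewrite /= !leaves_dctree // addnS addnn.
rewrite delta_dnodes /=.
  by rewrite !leaves_dctree // neq_ltn leqnn.
by rewrite !leaves_dctree // !dctreeP leqnn !andbT; lia.
Qed.

(** The centre is written as a successor, so that the left neighbour [n] needs
no truncated subtraction. *)
Lemma delta_second_difference a q n :
  0 < q -> n.+1 = 2 ^ a * q.*2.+1 ->
  delta n + delta n.+2 + 2 = (delta n.+1).*2 + a.*2.
Proof.
move=> q_gt0; elim: a n => [|a IHa] n.
  rewrite mul1n => -[->]; rewrite -doubleS !delta_double // delta_doubleS //.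
  lia.
rewrite expnS -mulnA.
case def_m: (2 ^ a * q.*2.+1) => [|m] def_n; first by lia.
(* The odd part is at least 3, so the left neighbour at level [a] is positive
   and the recurrence for odd arguments applies to it. *)
have m_gt0 : 0 < m.
  by rewrite -ltnS -def_m (@leq_trans (1 * q.*2.+1)) ?leq_mul ?expn_gt0 //; lia.
have -> : n = m.*2.+1 by lia.
rewrite -doubleS delta_double // !delta_doubleS //.
by have := IHa m (esym def_m); lia.
Qed.

Lemma dvdn_exp2_bit r a : (forall i, i < a -> ~~ bit r i) -> 2 ^ a %| r.
Proof.
elim: a => [|a IHa] lo; first exact: dvd1n.
have a_r : 2 ^ a %| r by apply: IHa => i lt_ia; apply: lo; apply: ltnW.
by rewrite expnS -dvdn_divRL // dvdn2; apply: lo.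
Qed.

(** Adding [2 ^ k] does not move the lowest bit of [r], since [2 ^ a <= r < 2 ^ k]
puts that bit strictly below position [k]; the added power contributes
[2 ^ (k - a.+1)], which is positive, to [q]. *)
Lemma exp2_add_odd_part k r a :
    0 < r < 2 ^ k -> bit r a -> (forall i, bit r i -> a <= i) ->
  exists2 q, 0 < q & 2 ^ k + r = 2 ^ a * q.*2.+1.
Proof.
move=> /andP[r_gt0 lt_rk] bit_a min_a.
have a_r : 2 ^ a %| r.
  by apply: dvdn_exp2_bit => i; rewrite ltnNge; apply/contra/min_a.
have lt_ak : a < k.
  by rewrite -(ltn_exp2l _ _ (ltnSn 1)) (leq_ltn_trans (dvdn_leq _ a_r)).
exists (2 ^ (k - a.+1) + (r %/ 2 ^ a)./2); first by rewrite addn_gt0 expn_gt0.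
have odd_c : odd (r %/ 2 ^ a) := bit_a.
rewrite doubleD -addnS -[X in _ + X = _](divnK a_r).
have -> : (r %/ 2 ^ a)./2.*2.+1 = r %/ 2 ^ a.
  by rewrite -[RHS]odd_double_half odd_c.
rewrite mulnDr -mul2n -expnS -subSn // subSS -expnD subnKC 1?ltnW //.
by rewrite [in RHS]mulnC.
Qed.

Import GRing.Theory.
Local Open Scope ring_scope.

Theorem corollary10 (n k r rho1 : nat)
  (hn : n = (2 ^ k + r)%N)
  (hr0 : (0 < r)%N)
  (hrk : (r < 2 ^ k)%N)
  (hbit : bit r rho1)
  (hmin : forall i : nat, bit r i -> (rho1 <= i)%N) :
  (delta n)%:R =
    (1 / 2) * ((delta (n - 1))%:R + (delta (n + 1))%:R) + 1 - rho1%:R :> rat.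
Proof.
have r_range : (0 < r < 2 ^ k)%N by rewrite hr0.
have [q q_gt0] := exp2_add_odd_part r_range hbit hmin; rewrite -hn => def_n.
case: n => [|n] in hn def_n *; first by lia.
rewrite subn1 addn1 /=.
have /(congr1 (fun m => m%:R : rat)) := delta_second_difference q_gt0 def_n.
rewrite -!muln2 !natrD !natrM; lra.
Qed.
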